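(* Let $g:\mathbb{R}^{d-1}\to\mathbb{R}$ be Lipschitz continuous with Lipschitz constant $c_g>0$ and $g(0)=0$. For $L\ge2$ put $$\Sigma'_L:=B_L\cap\{x=(x',x_d): g(x')-1<x_d<g(x')\},\qquad \partial_b\Sigma'_L:=B_L\cap\{x=(x',x_d):x_d=g(x')-1\},$$ and let $w_{1,L},w_{2,L}\ge0$ solve $$-\Delta w_{1,L}=0,\quad -\Delta w_{2,L}=1\quad\text{in }\Sigma'_L,$$ $$w_{1,L}=1,\ w_{2,L}=0\ \text{ on }\partial_b\Sigma'_L;\qquad w_{1,L}=w_{2,L}=0\ \text{ on the rest of }\partial\Sigma'_L.$$ If $c_g<\cot\theta_2$, then there is a constant $C=C(d,c_g)$, independent of $L\ge 2$, such that $$w_{2,L}\le C\,w_{1,L}\quad\text{in }\Sigma'_{L-1}.$$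
   Context: $B_L$ is the open ball of radius $L$ in $\mathbb{R}^d$ centered at the origin; points are written $x=(x',x_d)\in\mathbb{R}^{d-1}\times\mathbb{R}$; $\Sigma'_{L-1}$ is defined by the same formula with $B_{L-1}$ in place of $B_L$. The angle $\theta_2$: for $\theta\in(0,\pi)$ and $\mu\in\mathbb{S}^{d-1}$ let $W_{\theta,\mu}$ be the set of $p\in\mathbb{R}^d$ whose angle with $\mu$ is at most $\theta$. For $\beta\in(1,2]$, $\theta_\beta\in(0,\frac\pi2)$ is the half-opening for which the positive homogeneous harmonic function in $W_{\theta_\beta,\mu}$ vanishing on $\partial W_{\theta_\beta,\mu}$ has degree $\beta$; it depends only on $d$ and $\beta$, is continuous and decreasing in $\beta$, tends to $\frac\pi2$ as $\beta\to1$, and for $\beta\in(1,2)$ it has the property that for some $c\in(0,1)$, if $\theta\ge\theta_\beta$, every non-negative harmonic $\omega$ in $W_{\theta,\mu}\cap B_2$ with $\sup_{W_{\theta,\mu}\cap B_1}\omega=1$ and $\omega=0$ on $\partial W_{\theta,\mu}\cap B_2$ satisfies $\omega(s\mu)\ge cs^\beta$ for $s\in(0,1)$. $\theta_2$ is this angle for $\beta=2$. *)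

(* Defs.v *)
From HB Require Import structures.
From mathcomp Require Import all_boot all_order all_algebra.
From mathcomp Require Import all_classical all_reals all_analysis.

Set Implicit Arguments.
Unset Strict Implicit.
Unset Printing Implicit Defensive.

Import Order.TTheory GRing.Theory Num.Theory.
Import numFieldNormedType.Exports.

Local Open Scope classical_set_scope.
Local Open Scope ring_scope.

(* The norm [`|x|] that the library puts on ['rV[R]_d] is the sup norm, hence
   the separate Euclidean norm; the two induce the same topology. *)
Definition dot (R : realType) (d : nat) (x y : 'rV[R]_d) : R :=
  \sum_(i < d) x 0 i * y 0 i.

Definition enorm (R : realType) (d : nat) (x : 'rV[R]_d) : R :=
  Num.sqrt (dot x x).

Definition eball (R : realType) (d : nat) (L : R) : set 'rV[R]_d :=
  [set x | enorm x < L].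

Definition elipschitz (R : realType) (d : nat) (c : R) (g : 'rV[R]_d -> R) :=
  forall x y, `|g x - g y| <= c * enorm (x - y).

Definition boundary (T : topologicalType) (A : set T) : set T :=
  closure A `\` A°.

Definition partial (R : realType) (d : nat) (i : 'I_d) (f : 'rV[R]_d -> R) :
  'rV[R]_d -> R := 'D_(delta_mx 0 i) f.

Definition C2_on (R : realType) (d : nat) (U : set 'rV[R]_d)
    (f : 'rV[R]_d -> R) : Prop :=
  forall x, U x ->
    [/\ {for x, continuous f},
        forall i, derivable f x (delta_mx 0 i) /\
                  {for x, continuous (partial i f)} &
        forall i j, derivable (partial i f) x (delta_mx 0 j) /\
                    {for x, continuous (partial j (partial i f))}].

Definition laplacian (R : realType) (d : nat) (f : 'rV[R]_d -> R)
    (x : 'rV[R]_d) : R :=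
  \sum_(i < d) partial i (partial i f) x.

(* Classical solution of [- laplacian w = f] in the open set [U], [w = phi] on
   its boundary. The datum [phi] may jump along the boundary: the value
   [phi xi] is attained, as a limit from inside [U], at each [xi] where [phi]
   restricted to the boundary is continuous. The values of [phi] and [w] away
   from the boundary and from [U] respectively are irrelevant. *)
Definition dirichlet_solution (R : realType) (d : nat) (U : set 'rV[R]_d)
    (f phi w : 'rV[R]_d -> R) : Prop :=
  [/\ C2_on U w,
      forall x, U x -> - laplacian w x = f x &
      forall xi, boundary U xi ->
        phi y @[y --> within (boundary U) (nbhs xi)] --> phi xi ->
        w x @[x --> within U (nbhs xi)] --> phi xi].

Definition angle (R : realType) (d : nat) (p q : 'rV[R]_d) : R :=
  acos (dot p q / (enorm p * enorm q)).

(* The apex is included separately: its angle with [mu] is undefined. *)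
Definition cone (R : realType) (d : nat) (theta : R) (mu : 'rV[R]_d) :
  set 'rV[R]_d := [set p | p = 0 \/ angle p mu <= theta].

Definition is_half_opening (R : realType) (d : nat) (beta theta : R) : Prop :=
  0 < theta < pi / 2 /\
  forall mu : 'rV[R]_d, enorm mu = 1 ->
    exists u : 'rV[R]_d -> R,
      [/\ dirichlet_solution (cone theta mu)° (cst 0) (cst 0) u,
          forall x, (cone theta mu)° x -> 0 < u x &
          forall (t : R) x, 0 < t -> (cone theta mu)° x ->
            u (t *: x) = t `^ beta * u x].

Definition cot (R : realType) (x : R) : R := cos x / sin x.

(* A point [x : 'rV_n.+1] is [(x', x_d)] with [d = n.+1]. *)
Definition xprime (R : realType) (n : nat) (x : 'rV[R]_n.+1) : 'rV[R]_n :=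
  col' ord_max x.

Definition xlast (R : realType) (n : nat) (x : 'rV[R]_n.+1) : R :=
  x 0 ord_max.

Definition Sigma' (R : realType) (n : nat) (g : 'rV[R]_n -> R) (L : R) :
    set 'rV[R]_n.+1 :=
  eball L `&` [set x | g (xprime x) - 1 < xlast x < g (xprime x)].

Definition bottom_face (R : realType) (n : nat) (g : 'rV[R]_n -> R) (L : R) :
    set 'rV[R]_n.+1 :=
  eball L `&` [set x | xlast x = g (xprime x) - 1].

(* Main.v *)
(* For [d = n + 1] the condition on the slope is [n * cg ^ 2 < 1]: the harmonic
   function [n x_d ^ 2 - |x'| ^ 2] is positive exactly in a cone of opening
   [theta_2]. Fix [b] with [n < b ^ 2] and [b * cg < 1]. Then
   [b ^ 2 s ^ 2 - r ^ 2] is strictly subharmonic and nonpositive on the graph of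
   [g], where [s] and [r] are the vertical and horizontal distances to a point
   [y] of the graph. This bounds [w2] by a constant [B].
   To compare [w2] with [w1] at [x0], take [y] above [x0] and
     [Q = cosh (b k s) * exp (- k ^ 2 r ^ 2 / 2)].
   As [cosh t <= exp (t ^ 2 / 2)], [Q <= 1] on the graph, while
   [laplacian Q >= k ^ 2 (b ^ 2 - n) Q]; for [k] large, [{Q > 1 / 2}] is within
   the strip a thin column around the vertical through [x0], away from the sphere
   of radius [L]. For suitable constants [C] and [kap], [C w1 - w2 - kap (Q - 1)]
   is superharmonic in [{Q > 1 / 2}], and nonnegative on its boundary: where
   [Q = 1 / 2] because [w2 <= B <= kap / 2], on the graph because [w2 = 0]
   and [Q <= 1], on the bottom face because [w1 = 1]. Since [Q x0 >= 1],
   the claim follows. *)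
Require Import Defs.
From HB Require Import structures.
From mathcomp Require Import all_boot all_order all_algebra.
From mathcomp Require Import all_classical all_reals all_analysis.
From mathcomp Require Import ring lra.

Set Implicit Arguments.
Unset Strict Implicit.
Unset Printing Implicit Defensive.

Import Order.TTheory GRing.Theory Num.Theory.
Import numFieldNormedType.Exports.

Local Open Scope classical_set_scope.
Local Open Scope ring_scope.

(** * A Gaussian bound for the hyperbolic cosine *)

Lemma le_of_derive_le0 (R : realType) (F dF : R -> R) (x : R) :
  (forall c, is_derive c (1 : R) F (dF c)) -> (forall c, 0 <= c -> dF c <= 0) ->
  0 <= x -> F x <= F 0.
Proof.
move=> Fd dF0 x0.
have cF : {within `[0, x], continuous F}.
  by apply: derivable_within_continuous => t _; case: (Fd t).
have [c] := @MVT_segment R F dF 0 x x0 (fun t _ => Fd t) cF.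
rewrite in_itv /= => /andP[c0 _] eqF.
rewrite -subr_le0 eqF subr0.
by rewrite mulr_le0_ge0 // dF0.
Qed.

Definition cosh (R : realType) (x : R) : R := (expR x + expR (- x)) / 2.

(** For [z >= 0] the function [cosh z * exp (- z ^ 2 / 2)] is nonincreasing: the sign of its
    derivative amounts to [tanh z <= z], which [key] states without division. *)
Lemma cosh_le_gauss (R : realType) (x : R) : cosh x <= expR (x ^+ 2 / 2).
Proof.
wlog x0 : x / 0 <= x.
  move=> H; have [/H//|x0] := leP 0 x.
  by have := H (- x); rewrite /cosh opprK sqrrN addrC => -> //; rewrite oppr_ge0 ltW.
have key (y : R) : 0 <= y -> (1 - y) * expR (2 * y) <= 1 + y.
  move=> y0.
  pose F (z : R) := (1 - z) * expR (2 * z) - (1 + z).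
  have /(_ y y0) : forall y, 0 <= y -> F y <= F 0.
    move=> z z0.
    apply: (@le_of_derive_le0 _ _ (fun c => (1 - 2 * c) * expR (2 * c) - 1)) => //.
      move=> c; rewrite /F; apply: is_derive_eq.
      by rewrite /GRing.scale /=; ring.
    move=> c _; rewrite subr_le0.
    have := expR_ge1Dx (- (2 * c)).
    rewrite expRN => h.
    rewrite -ler_pdivlMr ?expR_gt0 // div1r; lra.
  rewrite /F mulr0 expR0; lra.
pose F (z : R) := expR (z - z ^+ 2 / 2) + expR (- z - z ^+ 2 / 2).
have : F x <= F 0.
  apply: (@le_of_derive_le0 _ _ (fun z => (1 - z) * expR (z - z ^+ 2 / 2) - (1 + z) * expR (- z - z ^+ 2 / 2))) => //.
    move=> c; rewrite /F; apply: is_derive_eq.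
    by rewrite /GRing.scale /=; field.
  move=> c c0.
  have -> : c - c ^+ 2 / 2 = 2 * c + (- c - c ^+ 2 / 2) by field.
  rewrite expRD mulrA -mulrBl.
  rewrite mulr_le0_ge0 ?expR_ge0 // subr_le0; exact: key.
rewrite /F expr0n /= mul0r !(oppr0, addr0) expR0 !expRD !expRN -mulrDl.
rewrite ler_pdivrMr ?expR_gt0 // => h.
by rewrite /cosh ler_pdivrMr // mulrC expRN.
Qed.

(** * Second derivatives along lines *)

(** Relational, with the first derivative [df] asked for only near [0]: solutions, smooth only in an
    open set, and explicit barriers can then be combined linearly without evaluating [partial]. *)
Definition is_derive2 (R : realType) (d : nat) (f : 'rV[R]_d -> R) (x v : 'rV[R]_d)
    (a : R) :=
  exists df : R -> R,
    (\forall t \near (0 : R), is_derive t (1 : R) (fun t => f (x + t *: v)) (df t)) /\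
    is_derive (0 : R) (1 : R) df a.

Lemma is_derive_lin (R : realType) (f g : R -> R) (c : R) (t df dg : R) :
  is_derive t (1 : R) f df -> is_derive t (1 : R) g dg ->
  is_derive t (1 : R) (fun t => f t + c * g t) (df + c * dg).
Proof.
move=> Hf Hg.
have H : is_derive t (1 : R) (f + c \*: g) (df + c *: dg).
  by apply: is_deriveD; exact: is_deriveZ.
exact: H.
Qed.

Lemma is_derive2_lin (R : realType) (d : nat) (f g : 'rV[R]_d -> R) (x v : 'rV[R]_d)
    (c a b : R) :
  is_derive2 f x v a -> is_derive2 g x v b -> is_derive2 (fun y => f y + c * g y) x v (a + c * b).
Proof.
move=> [df [Hf Hdf]] [dg [Hg Hdg]].
exists (fun t => df t + c * dg t); split; last exact: is_derive_lin.
near=> t; apply: is_derive_lin; [near: t; exact: Hf|near: t; exact: Hg].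
Unshelve. all: by end_near. Qed.

Lemma is_derive2_cst (R : realType) (d : nat) (c : R) (x v : 'rV[R]_d) :
  is_derive2 (fun=> c) x v 0.
Proof.
exists (fun=> 0); split; last exact: is_derive_cst.
by near=> t; exact: is_derive_cst.
Unshelve. all: by end_near. Qed.

Lemma is_derive2_min (R : realType) (d : nat) (f : 'rV[R]_d -> R) (x v : 'rV[R]_d)
    (a : R) :
  is_derive2 f x v a -> (\forall t \near (0 : R), f x <= f (x + t *: v)) -> 0 <= a.
Proof.
move=> [df [Hf Hdf]] Hmin.
pose F (t : R) := f (x + t *: v).
have [e /= e0 He] : \forall t \near (0 : R), is_derive t (1 : R) F (df t) /\ F 0 <= F t.
  near=> t; split; first by near: t; exact: Hf.
  by rewrite {1}/F scale0r addr0; near: t; exact: Hmin.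
have {}He t : `|t| < e -> is_derive t (1 : R) F (df t) /\ F 0 <= F t.
  by move=> te; apply: He; rewrite /= sub0r normrN.
have in_e t : t \in `]- e, e[%R -> `|t| < e.
  by rewrite in_itv /= ltr_norml.
have df0 : df 0 = 0.
  have H0 : is_derive (0:R) (1:R) F 0.
    apply: (@derive1_at_min R F (- e) e 0).
    - lra.
    - by move=> t /in_e /He [[]].
    - by rewrite in_itv /=; lra.
    - by move=> t /in_e /He [].
  have [H1 _] := He 0 (ltac:(by rewrite normr0)).
  by have := @derive_val _ _ _ _ _ _ _ H1; rewrite (@derive_val _ _ _ _ _ _ _ H0).
(* If [a < 0], then [df], which vanishes at [0], is negative just to the right of it, and the mean
   value theorem puts [F h] below the minimum [F 0]. *)
rewrite leNgt; apply/negP => a0.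
have [Hd Hv] := Hdf.
have : (fun h => h^-1 *: ((df \o shift 0) (h *: (1:R)) - df 0)) @ (0:R)^' --> a.
  by move: Hv; rewrite /derive => <-; exact: Hd.
move=> /cvgr_lt /(_ _ a0) [e1 /= e10 He1].
pose h := Num.min e e1 / 2.
have m0 : 0 < Num.min e e1 by rewrite lt_min e0.
have h0 : 0 < h by rewrite /h divr_gt0.
have hm : h < Num.min e e1 by rewrite /h; lra.
move: hm; rewrite lt_min => /andP[he he1].
have cF : {within `[0, h], continuous F}.
  apply: derivable_within_continuous => t; rewrite in_itv /= => /andP[t0 th].
  by have [] : is_derive t (1 : R) F (df t) /\ F 0 <= F t by apply: He; rewrite ger0_norm //; lra.
have [c hc eqF] := @MVT R F df 0 h h0 (fun t ht => (He t (ltac:(move: ht; rewrite in_itv /= => /andP[t0 th]; rewrite gtr0_norm //; lra))).1) cF.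
move: hc; rewrite in_itv /= => /andP[c0 hc].
have : df c < 0.
  have := He1 c; rewrite /= sub0r normrN gtr0_norm // => /(_ ltac:(lra)) /(_ (lt0r_neq0 c0)).
  by rewrite df0 subr0 /GRing.scale /= mulr1 addr0 pmulr_rlt0 // invr_gt0.
have [_ F0h] := He h (ltac:(rewrite gtr0_norm //; lra)).
move=> dfc; have : df c * (h - 0) < 0 by rewrite nmulr_rlt0 // subr0.
by rewrite -eqF; lra.
Unshelve. all: by end_near. Qed.

Lemma is_derive_line (R : realType) (d : nat) (f : 'rV[R]_d -> R)
    (x v : 'rV[R]_d) (t df : R) :
  is_derive (x + t *: v) v f df -> is_derive t (1 : R) (fun t => f (x + t *: v)) df.
Proof.
have E : (fun h => h^-1 *: (((fun t => f (x + t *: v)) \o shift t) (h *: (1:R))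
    - f (x + t *: v))) =
  (fun h => h^-1 *: ((f \o shift (x + t *: v)) (h *: v) - f (x + t *: v))).
  apply/funext => h /=; congr (_ *: (f _ - _)).
  by rewrite [h *: 1]mulr1 scalerDl addrCA.
move=> [Hd Hv]; split.
  by rewrite /derivable E.
by rewrite /derive E; exact: Hv.
Qed.

Lemma line_near (R : realType) (d : nat) (U : set 'rV[R]_d) (x v : 'rV[R]_d) :
  open U -> U x -> \forall t \near (0 : R), U (x + t *: v).
Proof.
move=> oU Ux.
have : (x + t *: v) @[t --> (0:R)] --> x + (0 : R) *: v.
  by apply: cvgD; [exact: cvg_cst|apply: cvgZr_tmp; exact: cvg_id].
by rewrite scale0r addr0; apply; exact: open_nbhs_nbhs.
Qed.

Lemma is_derive2_partial (R : realType) (d : nat) (U : set 'rV[R]_d)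
    (w : 'rV[R]_d -> R) (x : 'rV[R]_d) (i : 'I_d) :
  open U -> C2_on U w -> U x ->
  is_derive2 w x (delta_mx 0 i) (partial i (partial i w) x).
Proof.
move=> oU C2 Ux; exists (fun t => partial i w (x + t *: delta_mx 0 i)); split.
  near=> t; apply: is_derive_line; apply: DeriveDef => //.
  have /C2[_ /(_ i)[]//] : U (x + t *: delta_mx 0 i).
  by near: t; exact: line_near.
apply: is_derive_line; rewrite scale0r addr0; apply: DeriveDef => //.
by have [_ _ /(_ i i)[]] := C2 _ Ux.
Unshelve. all: by end_near. Qed.

Lemma is_derive2_expR_quad (R : realType) (d : nat) (f : 'rV[R]_d -> R)
    (x v : 'rV[R]_d) (A B D : R) :
  (forall t, f (x + t *: v) = expR (A + B * t + D * t ^+ 2)) ->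
  is_derive2 f x v ((2 * D + B ^+ 2) * expR A).
Proof.
move=> H; exists (fun t => (B + 2 * D * t) * expR (A + B * t + D * t ^+ 2)); split.
  near=> t; rewrite (_ : (fun t => _) = (fun t => expR (A + B * t + D * t ^+ 2))); last exact/funext.
  by apply: is_derive_eq; rewrite /GRing.scale /=; ring.
apply: is_derive_eq.
rewrite /GRing.scale /= expr0n /= !mulr0 !addr0; ring.
Unshelve. all: by end_near. Qed.

Lemma is_derive2_quad (R : realType) (d : nat) (f : 'rV[R]_d -> R)
    (x v : 'rV[R]_d) (A B D : R) :
  (forall t, f (x + t *: v) = A + B * t + D * t ^+ 2) -> is_derive2 f x v (2 * D).
Proof.
move=> H; exists (fun t => B + 2 * D * t); split.
  near=> t; rewrite (_ : (fun t => _) = (fun t => A + B * t + D * t ^+ 2)); last exact/funext.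
  by apply: is_derive_eq; rewrite /GRing.scale /=; ring.
by apply: is_derive_eq; rewrite /GRing.scale /=; ring.
Unshelve. all: by end_near. Qed.

(** * Explicit barriers *)

Definition hdist2 (R : realType) (n : nat) (p : 'rV[R]_n) (x : 'rV[R]_n.+1) : R :=
  dot (xprime x - p) (xprime x - p).

Lemma dot_ge0 (R : realType) (d : nat) (x : 'rV[R]_d) : 0 <= dot x x.
Proof. by apply: sumr_ge0 => i _; exact: sqr_ge0. Qed.

Lemma hdist2_ge0 (R : realType) (n : nat) (p : 'rV[R]_n) x : 0 <= hdist2 p x.
Proof. exact: dot_ge0. Qed.

Lemma enorm_sqr (R : realType) (d : nat) (x : 'rV[R]_d) : enorm x ^+ 2 = dot x x.
Proof. by rewrite sqr_sqrtr // dot_ge0. Qed.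

Lemma dot_prime_last (R : realType) (n : nat) (x y : 'rV[R]_n.+1) :
  dot x y = dot (xprime x) (xprime y) + xlast x * xlast y.
Proof.
rewrite /dot (bigD1_ord ord_max) //= addrC; congr (_ + _).
by apply: eq_bigr => i _; rewrite !mxE.
Qed.

Lemma dot_line (R : realType) (d : nat) (x : 'rV[R]_d) (j : 'I_d) (t : R) :
  dot (x + t *: delta_mx 0 j) (x + t *: delta_mx 0 j) =
  dot x x + 2 * x 0 j * t + t ^+ 2.
Proof.
rewrite /dot (bigD1 j) //= [in RHS](bigD1 j) //= !mxE !eqxx /=.
have -> : \sum_(i < d | i != j) (x + t *: delta_mx 0 j) 0 i * (x + t *: delta_mx 0 j) 0 i
  = \sum_(i < d | i != j) x 0 i * x 0 i.
  by apply: eq_bigr => i /negbTE ij; rewrite !mxE eqxx ij /= mulr0 addr0.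
ring.
Qed.

Lemma xlast_max (R : realType) (n : nat) (x : 'rV[R]_n.+1) (t : R) :
  xlast (x + t *: delta_mx 0 ord_max) = xlast x + t.
Proof. by rewrite /xlast !mxE !eqxx mulr1. Qed.

Lemma xlast_lift (R : realType) (n : nat) (x : 'rV[R]_n.+1) (t : R) (j : 'I_n) :
  xlast (x + t *: delta_mx 0 (lift ord_max j)) = xlast x.
Proof. by rewrite /xlast !mxE (negbTE (neq_lift _ _)) andbF mulr0 addr0. Qed.

Lemma xprime_max (R : realType) (n : nat) (x : 'rV[R]_n.+1) (t : R) :
  xprime (x + t *: delta_mx 0 ord_max) = xprime x.
Proof.
by apply/rowP => i; rewrite !mxE eq_sym (negbTE (neq_lift _ _)) andbF mulr0 addr0.
Qed.

Lemma xprime_lift (R : realType) (n : nat) (x : 'rV[R]_n.+1) (t : R) (j : 'I_n) :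
  xprime (x + t *: delta_mx 0 (lift ord_max j)) = xprime x + t *: delta_mx 0 j.
Proof. by apply/rowP => i; rewrite !mxE (inj_eq lift_inj). Qed.

Lemma hdist2_max (R : realType) (n : nat) (p : 'rV[R]_n) (x : 'rV[R]_n.+1) (t : R) :
  hdist2 p (x + t *: delta_mx 0 ord_max) = hdist2 p x.
Proof. by rewrite /hdist2 xprime_max. Qed.

Lemma hdist2_lift (R : realType) (n : nat) (p : 'rV[R]_n) (x : 'rV[R]_n.+1) (t : R)
    (j : 'I_n) :
  hdist2 p (x + t *: delta_mx 0 (lift ord_max j)) =
  hdist2 p x + 2 * (xprime x - p) 0 j * t + t ^+ 2.
Proof. by rewrite /hdist2 xprime_lift addrAC dot_line. Qed.

Definition has_laplacian (R : realType) (d : nat) (f : 'rV[R]_d -> R) (x : 'rV[R]_d)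
    (a : R) :=
  exists2 b : 'I_d -> R, (forall i, is_derive2 f x (delta_mx 0 i) (b i)) &
    a = \sum_(i < d) b i.

Lemma has_laplacian_lin (R : realType) (d : nat) (f g : 'rV[R]_d -> R) (x : 'rV[R]_d)
    (c a b : R) :
  has_laplacian f x a -> has_laplacian g x b -> has_laplacian (fun y => f y + c * g y) x (a + c * b).
Proof.
move=> [a' Ha ->] [b' Hb ->]; exists (fun i => a' i + c * b' i).
  by move=> i; exact: is_derive2_lin.
by rewrite big_split /= mulr_sumr.
Qed.

Lemma has_laplacian_cst (R : realType) (d : nat) (c : R) (x : 'rV[R]_d) :
  has_laplacian (fun=> c) x 0.
Proof. by exists (fun=> 0); [move=> i; exact: is_derive2_cst|rewrite big1]. Qed.

Lemma has_laplacian_laplacian (R : realType) (d : nat) (U : set 'rV[R]_d)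
    (w : 'rV[R]_d -> R) (x : 'rV[R]_d) :
  open U -> C2_on U w -> U x -> has_laplacian w x (laplacian w x).
Proof.
move=> oU C2 Ux; exists (fun i => partial i (partial i w) x) => // i.
exact: is_derive2_partial C2 Ux.
Qed.

Lemma has_laplacian_min (R : realType) (d : nat) (U : set 'rV[R]_d) (f : 'rV[R]_d -> R)
    (x : 'rV[R]_d) (a : R) :
  open U -> U x -> (forall y, U y -> f x <= f y) -> has_laplacian f x a -> 0 <= a.
Proof.
move=> oU Ux Hmin [b Hb ->]; apply: sumr_ge0 => i _.
apply: (is_derive2_min (Hb i)).
near=> t; apply: Hmin; near: t; exact: line_near.
Unshelve. all: by end_near. Qed.

(** Serves twice: with [a = b ^ 2 > n] and vertex on the graph it is subharmonic and bounds [w2];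
    with [a < n] and vertex at the origin it is superharmonic and constrains the opening
    [theta2]. *)
Definition quad (R : realType) (n : nat) (a c : R) (p : 'rV[R]_n)
    (x : 'rV[R]_n.+1) : R := a * (xlast x - c) ^+ 2 - hdist2 p x.

Lemma has_laplacian_quad (R : realType) (n : nat) (a c : R) (p : 'rV[R]_n) x :
  has_laplacian (quad a c p) x (2 * (a - n%:R)).
Proof.
exists (fun i => 2 * (if i == ord_max then a else -1)).
  move=> i; case: (unliftP ord_max i) => [j ->|->].
    rewrite eq_sym (negbTE (neq_lift _ _)).
    apply: (@is_derive2_quad _ _ _ _ _ (quad a c p x) (- 2 * (xprime x - p) 0 j)) => t.
    by rewrite /quad xlast_lift hdist2_lift; ring.
  rewrite eqxx.
  apply: (@is_derive2_quad _ _ _ _ _ (quad a c p x) (2 * a * (xlast x - c))) => t.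
  by rewrite /quad xlast_max hdist2_max; ring.
rewrite (bigD1_ord ord_max) //= eqxx.
rewrite (eq_bigr (fun=> -2)); last first.
  by move=> i _; rewrite eq_sym (negbTE (neq_lift _ _)) mulrN1.
rewrite sumr_const card_ord -mulr_natr; ring.
Qed.

(** One exponential of the [cosh] in [Q]. Along each coordinate line the exponent is a quadratic
    polynomial, so [is_derive2_expR_quad] gives every second derivative. The Gaussian rate [k] here
    becomes [K = k ^ 2] in the comparison. *)
Definition wave (R : realType) (n : nat) (s k c : R) (p : 'rV[R]_n)
    (x : 'rV[R]_n.+1) : R :=
  expR (s * (c - xlast x) - k / 2 * hdist2 p x).

Lemma has_laplacian_wave (R : realType) (n : nat) (s k c : R) (p : 'rV[R]_n) x :
  has_laplacian (wave s k c p) x ((s ^+ 2 + k ^+ 2 * hdist2 p x - n%:R * k) * wave s k c p x).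
Proof.
exists (fun i => (if unlift ord_max i is Some j
    then 2 * (- k / 2) + (- k * (xprime x - p) 0 j) ^+ 2
    else 2 * 0 + (- s) ^+ 2) * wave s k c p x).
  move=> i; case: (unliftP ord_max i) => [j ->|->]; apply: is_derive2_expR_quad => t.
    by rewrite /wave xlast_lift hdist2_lift; congr expR; field.
  by rewrite /wave xlast_max hdist2_max; congr expR; field.
rewrite (bigD1_ord ord_max) //= unlift_none -mulr_suml -mulrDl.
congr (_ * _).
rewrite [in RHS](eq_bigr (fun j => k ^+ 2 * ((xprime x - p) 0 j * (xprime x - p) 0 j) - k)); last first.
  by move=> j _; rewrite liftK; field.
rewrite big_split /= -mulr_sumr sumr_const card_ord -mulr_natr.
by rewrite /hdist2 /dot; ring.
Qed.

Lemma xlast_continuous (R : realType) (n : nat) :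
  continuous (@xlast R n : 'rV[R]_n.+1 -> R).
Proof. exact: coord_continuous. Qed.

Lemma sum_continuous (T : topologicalType) (R : realType) (d : nat)
    (f : 'I_d -> T -> R) :
  (forall i, continuous (f i)) -> continuous (fun x => \sum_(i < d) f i x).
Proof.
move=> cf; apply: continuous_big => // x; exact: add_continuous.
Qed.

Lemma hdist2_continuous (R : realType) (n : nat) (p : 'rV[R]_n) : continuous (hdist2 p).
Proof.
apply: sum_continuous => i x.
have c1 : {for x, continuous (fun x : 'rV[R]_n.+1 => (xprime x - p) 0 i)}.
  rewrite (_ : (fun x : 'rV[R]_n.+1 => _) = fun x => x 0 (lift ord_max i) - p 0 i);
    last by apply/funext => y; rewrite !mxE.
  by apply: continuousB; [exact: coord_continuous|exact: cst_continuous].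
exact: continuousM.
Qed.

Lemma enorm_continuous (R : realType) (d : nat) : continuous (@enorm R d).
Proof.
move=> x; apply: (@continuous_comp _ _ _ (fun x : 'rV[R]_d => dot x x) Num.sqrt);
  last exact: sqrt_continuous.
apply: sum_continuous => i y; apply: continuousM; exact: coord_continuous.
Qed.

Lemma norm_le_enorm (R : realType) (d : nat) (x : 'rV[R]_d) : `|x| <= enorm x.
Proof.
rewrite [leLHS]/Num.norm /= mx_normrE; apply: bigmax_le => [|[i j] _] /=.
  exact: sqrtr_ge0.
rewrite ord1 -sqrtr_sqr ler_wsqrtr // /dot (bigD1 j) //= -expr2 lerDl.
by apply: sumr_ge0 => k _; exact: sqr_ge0.
Qed.

Lemma compact_enorm (R : realType) (d : nat) (A : set 'rV[R]_d) (L : R) :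
  closed A -> (forall x, A x -> enorm x <= L) -> compact A.
Proof.
move=> cA bA; apply: bounded_closed_compact => //.
exists L; split; first exact: num_real.
move=> M LM x Ax /=; apply: le_trans (norm_le_enorm _) _.
exact: le_trans (bA _ Ax) (ltW LM).
Qed.

(** * Minimum principle *)

(** [min v 0], extended by zero outside [U], is continuous on the compact closure of [U]; a negative
    minimum would be attained in [U], where the Laplacian of [v] would have to be both nonnegative
    and negative. At the boundary [v] is only bounded from below in the limit, which suits data with
    jumps. *)
Lemma minimum_principle (R : realType) (d : nat) (U : set 'rV[R]_d) (L : R)
    (v : 'rV[R]_d -> R) :
  open U -> (forall x, U x -> enorm x <= L) ->
  (forall x, U x -> {for x, continuous v}) ->
  (forall xi, closure U xi -> ~ U xi -> forall e, 0 < e ->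
     \forall x \near within U (nbhs xi), - e < v x) ->
  (forall x, U x -> v x < 0 -> exists2 a, a < 0 & has_laplacian v x a) ->
  forall x, U x -> 0 <= v x.
Proof.
move=> oU bU cv vb vlap x0 Ux0; rewrite leNgt; apply/negP => vx0.
pose f x := if x \in U then Num.min (v x) 0 else 0.
have bK : forall x, closure U x -> enorm x <= L.
  have cL : closed [set x : 'rV[R]_d | enorm x <= L].
    apply: (@closed_comp _ _ (@enorm R d) [set y | y <= L]); last exact: closed_le.
    by move=> x _; exact: enorm_continuous.
  by move=> x /(closure_subset bU); rewrite -(closure_id _).1.
have cK : compact (closure U) by apply: compact_enorm bK; exact: closed_closure.
have fU x : U x -> f x = Num.min (v x) 0 by move=> Ux; rewrite /f mem_set.
have fN x : ~ U x -> f x = 0 by move=> Ux; rewrite /f memNset.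
have cfx (x : 'rV[R]_d) : closure U x -> f y @[y --> x] --> f x.
  move=> Kx; have [Ux|nUx] := pselect (U x).
    have cm : {for x, continuous (fun y => Num.min (v y) 0)}.
      by apply: continuous_min; [exact: cv|exact: cst_continuous].
    have E : \forall y \near x, Num.min (v y) 0 = f y.
      have : nbhs x U by exact: open_nbhs_nbhs.
      by apply: filterS => y Uy; rewrite fU.
    rewrite fU //; exact: cvg_trans (near_eq_cvg E) cm.
  rewrite fN //; apply/(@cvgrPdist_lt _ _ _ (nbhs x) (nbhs_filter x)) => e e0.
  have := vb x Kx nUx e e0; rewrite near_withinE; apply: filterS => y vy.
  rewrite sub0r normrN; have [Uy|nUy] := pselect (U y); last by rewrite fN // normr0.
  by rewrite fU // ltr_norml lt_min vy // gt_min e0 orbT oppr_lt0 e0.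
have cf : {within closure U, continuous f}.
  by apply: continuous_in_subspaceT => x; rewrite inE => /cfx.
have [c cU cmin] := compact_EVT_min (ex_intro _ x0 (subset_closure Ux0)) cK cf.
have fc0 : f c < 0.
  have := cmin x0; rewrite inE => /(_ (subset_closure Ux0)) h.
  apply: le_lt_trans h _; rewrite fU // gt_min vx0 //.
have Uc : U c by apply: contrapT => /fN fc; move: fc0; rewrite fc ltxx.
have vc : v c = f c.
  by move: fc0; rewrite fU // gt_min ltxx orbF /Num.min => ->.
have [a a0 Ha] := vlap c Uc (ltac:(by rewrite vc)).
have : 0 <= a.
  apply: (has_laplacian_min oU Uc _ Ha) => y Uy; rewrite vc.
  have := cmin y; rewrite inE => /(_ (subset_closure Uy)) h.
  by apply: le_trans h _; rewrite fU // ge_min lexx.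
by rewrite leNgt a0.
Qed.

(** * The strip below a Lipschitz graph *)

Lemma lip_sqr (R : realType) (n : nat) (c : R) (g : 'rV[R]_n -> R)
    (p : 'rV[R]_n) (x : 'rV[R]_n.+1) :
  0 <= c -> elipschitz c g ->
  (g (xprime x) - g p) ^+ 2 <= c ^+ 2 * hdist2 p x.
Proof.
move=> c0 hg; rewrite /hdist2 -enorm_sqr -exprMn -real_normK ?num_real //.
by rewrite ler_pXn2r ?nnegrE ?mulr_ge0 ?sqrtr_ge0.
Qed.

Lemma graph_continuous (R : realType) (n : nat) (c : R) (g : 'rV[R]_n -> R) :
  0 <= c -> elipschitz c g -> continuous (fun x : 'rV[R]_n.+1 => g (xprime x)).
Proof.
move=> c0 hg x.
have q0 : hdist2 (xprime x) x = 0.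
  by rewrite /hdist2 subrr /dot big1 // => i _; rewrite mxE mul0r.
have : hdist2 (xprime x) y @[y --> x] --> hdist2 (xprime x) x by exact: hdist2_continuous.
rewrite q0 => /(@cvgrPdist_lt _ _ _ (nbhs x) (nbhs_filter x)) H.
apply/(@cvgrPdist_lt _ _ _ (nbhs x) (nbhs_filter x)) => e e0.
have d0 : 0 < e ^+ 2 / (1 + c ^+ 2).
  by rewrite divr_gt0 ?exprn_gt0 // ltr_pwDl // sqr_ge0.
apply: filterS (H _ d0) => y; rewrite sub0r normrN ger0_norm ?hdist2_ge0 // => hy.
rewrite distrC -(@ltr_pXn2r _ 2) ?nnegrE ?(ltW e0) // real_normK ?num_real //.
apply: le_lt_trans (lip_sqr (xprime x) y c0 hg) _.
move: hy; rewrite ltr_pdivlMr ?ltr_pwDl ?sqr_ge0 //.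
have := hdist2_ge0 (xprime x) y; lra.
Qed.

Lemma open_lt_fun (T : topologicalType) (R : realType) (f h : T -> R) :
  continuous f -> continuous h -> open [set x | f x < h x].
Proof.
move=> cf cont_h.
rewrite (_ : [set x | _] = (h \- f) @^-1` [set y | 0 < y]); last first.
  by apply/seteqP; split => x /=; rewrite subr_gt0.
apply: open_comp; last exact: open_gt.
by move=> x _; apply: continuousB; [exact: cont_h|exact: cf].
Qed.

Lemma closure_le_fun (T : topologicalType) (R : realType) (f h : T -> R)
    (A : set T) :
  continuous f -> continuous h -> (forall x, A x -> f x <= h x) ->
  forall x, closure A x -> f x <= h x.
Proof.
move=> cf cont_h H x Ax; rewrite leNgt; apply/negP => hx.
have [y [Ay /=]] := Ax _ (open_nbhs_nbhs (conj (open_lt_fun cont_h cf) hx)).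
by rewrite ltNge H.
Qed.

Lemma open_Sigma' (R : realType) (n : nat) (c : R) (g : 'rV[R]_n -> R) (L : R) :
  0 <= c -> elipschitz c g -> open (Sigma' g L).
Proof.
move=> c0 hg; have cg := graph_continuous c0 hg.
rewrite (_ : Sigma' g L = [set x | enorm x < L] `&`
    ([set x | g (xprime x) - 1 < xlast x] `&` [set x | xlast x < g (xprime x)])); last first.
  apply/seteqP; split => x [] /= h1.
    by move=> /andP[h2 h3].
  by move=> [h2 h3]; split => //=; rewrite h2.
apply: openI.
  by apply: open_lt_fun; [exact: enorm_continuous|exact: cst_continuous].
apply: openI; apply: open_lt_fun => //; try exact: xlast_continuous.
by move=> x; apply: continuousB; [exact: cg|exact: cst_continuous].
Qed.

Lemma closure_Sigma' (R : realType) (n : nat) (c : R) (g : 'rV[R]_n -> R) (L : R) x :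
  0 <= c -> elipschitz c g -> closure (Sigma' g L) x ->
  g (xprime x) - 1 <= xlast x <= g (xprime x).
Proof.
move=> c0 hg Ax; have cg := graph_continuous c0 hg.
apply/andP; split.
  apply: (@closure_le_fun _ _ (fun y => g (xprime y) - 1) (@xlast R n)) Ax.
  - by move=> y; apply: continuousB; [exact: cg|exact: cst_continuous].
  - exact: xlast_continuous.
  - by move=> y [_ /andP[/ltW]].
apply: (@closure_le_fun _ _ (@xlast R n) (fun y => g (xprime y))) Ax => //.
  exact: xlast_continuous.
by move=> y [_ /andP[_ /ltW]].
Qed.

Lemma boundary_closure (T : topologicalType) (U : set T) x :
  closure U x -> ~ U x -> boundary U x.
Proof. by move=> cx nx; split => // /interior_subset. Qed.

Lemma quad_continuous (R : realType) (n : nat) (a c : R) (p : 'rV[R]_n) :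
  continuous (quad a c p).
Proof.
move=> x; suff : {for x, continuous (fun x => a * (xlast x - c) ^+ 2 - hdist2 p x)} by [].
apply: continuousB; last exact: hdist2_continuous.
apply: continuousM; first exact: cst_continuous.
apply: (@continuousM _ _ (fun x => xlast x - c) (fun x => xlast x - c));
  by apply: continuousB; [exact: xlast_continuous|exact: cst_continuous].
Qed.

(** * Uniform bound on [w2] *)

(** Here [D] is an increment of [g], [s] a height relative to the vertex and [q] a squared
    horizontal distance. Young's inequality for [s = D - t] with [t] in [[0, 1]] costs a factor
    [1 + eta] on [D ^ 2]; as [b * c < 1], a positive [eta] exists with
    [b ^ 2 * (1 + eta) * c ^ 2 = 1], and then the terms in [q] cancel. *)
Lemma quad_strip_bound (R : realType) (b c : R) :
  0 < b -> 0 < c -> b * c < 1 ->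
  exists2 M : R, 0 <= M &
    forall D s q : R, D ^+ 2 <= c ^+ 2 * q -> D - 1 <= s <= D ->
      b ^+ 2 * s ^+ 2 - q <= M.
Proof.
move=> b0 c0 bc.
have bc0 : 0 < b * c by rewrite mulr_gt0.
have bc2 : (b * c) ^+ 2 < 1 by rewrite expr_lt1 // ltW.
pose eta := ((b * c) ^+ 2)^-1 - 1.
have eta0 : 0 < eta by rewrite /eta subr_gt0 invf_gt1 // exprn_gt0.
have bne : b != 0 by rewrite gt_eqF.
have cne : c != 0 by rewrite gt_eqF.
have etaE : b ^+ 2 * (1 + eta) * c ^+ 2 = 1.
  by rewrite /eta; field; rewrite bne cne.
exists (b ^+ 2 * (1 + eta^-1)).
  by rewrite mulr_ge0 ?sqr_ge0 // addr_ge0 // invr_ge0 ltW.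
move=> D s q Dq /andP[s1 s2].
have hs : s ^+ 2 <= (1 + eta) * D ^+ 2 + (1 + eta^-1).
  pose t := D - s.
  have t01 : 0 <= t <= 1 by rewrite /t; apply/andP; split; lra.
  have -> : s = D - t by rewrite /t; ring.
  have : 0 <= (eta * D + t) ^+ 2 / eta by rewrite divr_ge0 ?sqr_ge0 // ltW.
  have -> : (eta * D + t) ^+ 2 / eta = eta * D ^+ 2 + 2 * D * t + t ^+ 2 / eta.
    by field; rewrite gt_eqF.
  have t2 : t ^+ 2 <= 1 by rewrite expr_le1 //; lra.
  have : t ^+ 2 / eta <= eta^-1 by rewrite ler_piMl // invr_ge0 ltW.
  nra.
have : b ^+ 2 * s ^+ 2 <= b ^+ 2 * ((1 + eta) * D ^+ 2 + (1 + eta^-1)).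
  by rewrite ler_wpM2l // sqr_ge0.
have : b ^+ 2 * (1 + eta) * D ^+ 2 <= b ^+ 2 * (1 + eta) * (c ^+ 2 * q).
  by rewrite ler_wpM2l // mulr_ge0 ?sqr_ge0 //; lra.
rewrite mulrA etaE mul1r; lra.
Qed.

(** The barrier is [k * (M - quad)], with the vertex of [quad] at the graph point above [x0]. It is
    nonnegative in the strip, and at most [k * M] at [x0] because [quad] is nonnegative on the
    vertical through its vertex. *)
Lemma torsion_bounded (R : realType) (n : nat) (b c : R) :
  0 < b -> 0 < c -> n%:R < b ^+ 2 -> b * c < 1 ->
  exists2 B : R, 0 <= B &
    forall (g : 'rV[R]_n -> R) (L : R) (w : 'rV[R]_n.+1 -> R),
      elipschitz c g -> dirichlet_solution (Sigma' g L) (cst 1) (cst 0) w ->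
      forall x, Sigma' g L x -> w x <= B.
Proof.
move=> b0 c0 nb bc; have [M M0 HM] := quad_strip_bound b0 c0 bc.
have bn0 : 0 < b ^+ 2 - n%:R by rewrite subr_gt0.
(* With this factor [k * quad] has Laplacian [2], so that [v] below has Laplacian [-2 + 1 = -1]. *)
pose k := (b ^+ 2 - n%:R)^-1.
have k0 : 0 < k by rewrite invr_gt0.
exists (k * M); first by rewrite mulr_ge0 // ltW.
move=> g L w hg [C2 eqw bdw] x0 Ux0.
have oU := open_Sigma' (L:=L) (ltW c0) hg.
pose p := xprime x0.
pose v x := k * M + - k * quad (b ^+ 2) (g p) p x + -1 * w x.
have Mq x : Sigma' g L x -> quad (b ^+ 2) (g p) p x <= M.
  move=> [_ /= /andP[x1 x2]].
  apply: (HM (g (xprime x) - g p)); first exact: lip_sqr (ltW c0) hg.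
  by apply/andP; split; lra.
suff : 0 <= v x0.
  rewrite /v /quad.
  have -> : hdist2 p x0 = 0.
    by rewrite /hdist2 subrr /dot big1 // => i _; rewrite mxE mul0r.
  have : 0 <= k * (b ^+ 2 * (xlast x0 - g p) ^+ 2).
    by rewrite mulr_ge0 ?(ltW k0) // mulr_ge0 ?sqr_ge0.
  lra.
apply: (@minimum_principle _ _ (Sigma' g L) L) Ux0 => //.
- by move=> x [/ltW].
- move=> x Ux; rewrite /v.
  apply: continuousD.
    apply: continuousD; first exact: cst_continuous.
    by apply: continuousM; [exact: cst_continuous|exact: quad_continuous].
  by apply: continuousM; [exact: cst_continuous|have [] := C2 x Ux].
- move=> xi cxi nxi e e0.
  have /bdw : boundary (Sigma' g L) xi by exact: boundary_closure.
  move=> /(_ (cvg_cst _)) /= H.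
  have : \forall x \near within (Sigma' g L) (nbhs xi), w x < e.
    by apply: cvgr_lt e0; exact: H.
  rewrite !near_withinE; apply: filterS => x hx Ux.
  have := hx Ux; have : k * quad (b ^+ 2) (g p) p x <= k * M.
    by rewrite ler_wpM2l ?(ltW k0) // Mq.
  rewrite /v; lra.
- move=> x Ux _; exists (0 + - k * (2 * (b ^+ 2 - n%:R)) + -1 * laplacian w x).
    have := eqw x Ux; rewrite /cst /= => hl.
    have -> : - k * (2 * (b ^+ 2 - n%:R)) = - 2 :> R.
      by rewrite /k; field; rewrite gt_eqF.
    lra.
  apply: has_laplacian_lin; last exact: has_laplacian_laplacian C2 Ux.
  by apply: has_laplacian_lin; [exact: has_laplacian_cst|exact: has_laplacian_quad].
Qed.

(** * The pulse: hyperbolic cosine in height, Gaussian in the horizontal distance *)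

Lemma cosh_ge1 (R : realType) (x : R) : 1 <= cosh x.
Proof.
rewrite /cosh; have := expR_ge1Dx x; have := expR_ge1Dx (- x); lra.
Qed.

Lemma cosh_le_expR (R : realType) (x y : R) : - y <= x <= y -> cosh x <= expR y.
Proof.
move=> /andP[x1 x2]; rewrite /cosh.
have : expR x <= expR y by rewrite ler_expR.
have : expR (- x) <= expR y by rewrite ler_expR; lra.
lra.
Qed.

Definition pulse (R : realType) (n : nat) (s k c : R) (p : 'rV[R]_n)
    (x : 'rV[R]_n.+1) : R := (wave s k c p x + wave (- s) k c p x) / 2.

Lemma pulseE (R : realType) (n : nat) (s k c : R) (p : 'rV[R]_n) x :
  pulse s k c p x = cosh (s * (c - xlast x)) * expR (- (k / 2 * hdist2 p x)).
Proof. by rewrite /pulse /wave /cosh !expRD mulNr; field. Qed.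

Lemma wave_continuous (R : realType) (n : nat) (s k c : R) (p : 'rV[R]_n) :
  continuous (wave s k c p).
Proof.
move=> x; apply: (@continuous_comp _ _ _
  (fun x => s * (c - xlast x) - k / 2 * hdist2 p x) expR);
  last exact: continuous_expR.
apply: continuousB; apply: continuousM; try exact: cst_continuous.
  by apply: continuousB; [exact: cst_continuous|exact: xlast_continuous].
exact: hdist2_continuous.
Qed.

Lemma pulse_continuous (R : realType) (n : nat) (s k c : R) (p : 'rV[R]_n) :
  continuous (pulse s k c p).
Proof.
move=> x; apply: (@continuousM _ _
  (fun x => wave s k c p x + wave (- s) k c p x) (cst 2^-1)).
  by apply: continuousD; exact: wave_continuous.
exact: cst_continuous.
Qed.

(** * Thin columns stay inside the ball *)

Lemma dotD_young (R : realType) (d : nat) (e : R) (x y : 'rV[R]_d) :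
  0 < e -> dot (x + y) (x + y) <= (1 + e) * dot x x + (1 + e^-1) * dot y y.
Proof.
move=> e0; rewrite /dot !mulr_sumr -big_split /=; apply: ler_sum => i _.
rewrite !mxE; set s := x 0 i; set t := y 0 i.
have : 0 <= (e * s - t) ^+ 2 / e by rewrite divr_ge0 ?sqr_ge0 // ltW.
have -> : (e * s - t) ^+ 2 / e = e * s ^+ 2 - 2 * s * t + t ^+ 2 / e.
  by field; rewrite gt_eqF.
lra.
Qed.

(* With [x0 = (p, q)] in the ball of radius [r = L - 1], the slack [r / 8 + 1 / 8]
   is [L / 8], so the points [(p, G - t)] stay at distance at least [1 / 16]
   from the sphere of radius [L]. *)
Lemma segment_in_ball (R : realType) (r P G q t : R) :
  1 <= r -> G ^+ 2 <= P -> P + q ^+ 2 < r ^+ 2 -> G - 1 < q < G ->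
  0 <= t <= 1 -> P + (G - t) ^+ 2 <= (r + 1) ^+ 2 - (r + 1) / 8.
Proof.
move=> r1 GP Pq /andP[q_lo q_hi] /andP[t0 t1].
(* The square is convex in [t], so the endpoints [t = 0] ([top]) and [t = 1] ([bot]) suffice. *)
have top : P + G ^+ 2 <= (r + 1) ^+ 2 - (r + 1) / 8.
  have [G1|G1] := leP 1 G.
    have h : (G - 1) ^+ 2 <= q ^+ 2 by nra.
    (* Since [G ^ 2 - q ^ 2 <= 2 * G - 1], this bound leaves a slack of [r / 4], which is at least
       [(r + 1) / 8]. *)
    have h1 : G <= 7 / 8 * r + 1 by nra.
    nra.
  have [G0|G0] := leP 0 G.
    have h : G ^+ 2 <= 1 by nra.
    nra.
  have h : G ^+ 2 <= q ^+ 2 by nra.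
  nra.
have bot : P + (G - 1) ^+ 2 <= (r + 1) ^+ 2 - (r + 1) / 8.
  have [G1|G1] := leP 1 G.
    have h : (G - 1) ^+ 2 <= q ^+ 2 by nra.
    nra.
  have [G0|G0] := leP 0 G.
    have h : (G - 1) ^+ 2 <= 1 by nra.
    nra.
  have h : G ^+ 2 <= q ^+ 2 by nra.
  have h1 : - G <= 3 / 4 * r by nra.
  nra.
have : (G - t) ^+ 2 <= (1 - t) * G ^+ 2 + t * (G - 1) ^+ 2.
  have : 0 <= t * (1 - t) by rewrite mulr_ge0 //; lra.
  lra.
nra.
Qed.

(** This is what the passage from radius [L] to [L - 1] provides. A point [x] at depth [t] below the
    graph is compared with the point at depth [t] on the vertical through [x0], which
    [segment_in_ball] controls. As [c <= 1], the two differ by at most [1 / 64] horizontally and at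
    most [1 / 64] vertically. *)
Lemma column_in_ball (R : realType) (n : nat) (c : R) (g : 'rV[R]_n -> R)
    (L : R) (x0 x : 'rV[R]_n.+1) :
  0 <= c <= 1 -> elipschitz c g -> g 0 = 0 -> 2 <= L -> Sigma' g (L - 1) x0 ->
  g (xprime x) - 1 <= xlast x <= g (xprime x) ->
  hdist2 (xprime x0) x <= 64^-1 ^+ 2 -> enorm x < L.
Proof.
move=> /andP[c0 c1] hg g0 hL [/= hx0 hx0g] /andP[xg1 xg2] hq.
pose p := xprime x0; pose P := dot p p; pose t := g (xprime x) - xlast x.
pose D := g (xprime x) - g p.
have c2 : c ^+ 2 <= 1 by rewrite expr_le1.
have L0 : 0 < L by exact: lt_le_trans hL.
have D2 : D ^+ 2 <= 64^-1 ^+ 2.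
  apply: le_trans (lip_sqr _ _ c0 hg) _.
  by apply: le_trans hq; rewrite ler_piMl // hdist2_ge0.
have G2 : g p ^+ 2 <= P.
  have := hg p 0; rewrite g0 !subr0 => h.
  rewrite /P -enorm_sqr -real_normK ?num_real // ler_pXn2r ?nnegrE ?sqrtr_ge0 //.
  by apply: le_trans h _; rewrite ler_piMl // sqrtr_ge0.
have P1 : P + (xlast x0) ^+ 2 < (L - 1) ^+ 2.
  rewrite expr2 -dot_prime_last -enorm_sqr ltr_pXn2r ?nnegrE ?sqrtr_ge0 //.
  by clear -hL; lra.
have seg : P + (g p - t) ^+ 2 <= L ^+ 2 - L / 8.
  have := @segment_in_ball R (L - 1) P (g p) (xlast x0) t.
  have -> : L - 1 + 1 = L by ring.
  by apply => //; [clear -hL; lra|rewrite /t; clear -xg1 xg2; lra].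
(* The weight in Young's inequality: [e * L ^ 2 = L / 32], and the two terms in [e^-1] cost [L / 64]
   together, both within the slack [L / 8]. *)
pose e := (32 * L)^-1.
have e0 : 0 < e by rewrite invr_gt0 mulr_gt0.
have eL : e * L = 32^-1 by rewrite /e; field; rewrite gt_eqF.
have eV : e^-1 = 32 * L by rewrite /e invrK.
have hX : dot (xprime x) (xprime x) <= (1 + e) * P + (1 + e^-1) * 64^-1 ^+ 2.
  have -> : xprime x = p + (xprime x - p) by rewrite addrC subrK.
  apply: le_trans (dotD_young p (xprime x - p) e0) _.
  by rewrite lerD2l ler_wpM2l // addr_ge0 // invr_ge0 ltW.
have hY : (xlast x) ^+ 2 <= (1 + e) * (g p - t) ^+ 2 + (1 + e^-1) * 64^-1 ^+ 2.
  have -> : xlast x = (g p - t) + D by rewrite /t /D; ring.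
  have : 0 <= (e * (g p - t) - D) ^+ 2 / e by rewrite divr_ge0 ?sqr_ge0 // ltW.
  have -> : (e * (g p - t) - D) ^+ 2 / e =
      e * (g p - t) ^+ 2 - 2 * (g p - t) * D + D ^+ 2 / e.
    by field; rewrite gt_eqF.
  have : (1 + e^-1) * D ^+ 2 <= (1 + e^-1) * 64^-1 ^+ 2.
    by rewrite ler_wpM2l // addr_ge0 // invr_ge0 ltW.
  clear; lra.
have : enorm x ^+ 2 < L ^+ 2.
  rewrite enorm_sqr dot_prime_last -expr2.
  have : (1 + e) * (P + (g p - t) ^+ 2) <= (1 + e) * (L ^+ 2 - L / 8).
    by rewrite ler_wpM2l // addr_ge0 // ltW.
  have -> : (1 + e) * (L ^+ 2 - L / 8) = L ^+ 2 - L / 8 + 32^-1 * L - 32^-1 / 8.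
    by rewrite -eL; ring.
  rewrite eV in hX hY.
  clear -hX hY L0; lra.
by rewrite ltr_pXn2r ?nnegrE ?sqrtr_ge0 // ltW.
Qed.

(** * Comparison of [w2] with [w1] *)

(** The indicator datum may jump only at the rim of the bottom face. Near a bottom point strictly
    inside the ball, every boundary point is inside the ball and below the graph, hence on the
    bottom face, so the datum is locally constant there. *)
Lemma bottom_datum (R : realType) (n : nat) (c : R) (g : 'rV[R]_n -> R)
    (L : R) (w : 'rV[R]_n.+1 -> R) (xi : 'rV[R]_n.+1) :
  0 <= c -> elipschitz c g ->
  dirichlet_solution (Sigma' g L) (cst 0) \1_(bottom_face g L) w ->
  closure (Sigma' g L) xi -> enorm xi < L -> xlast xi = g (xprime xi) - 1 ->
  w x @[x --> within (Sigma' g L) (nbhs xi)] --> (1 : R).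
Proof.
move=> c0 hg [_ _ bd] cxi nxi bxi.
have cg := graph_continuous c0 hg.
have ind1 : \1_(bottom_face g L) xi = 1 :> R by rewrite indicE mem_set.
have bxiU : boundary (Sigma' g L) xi.
  by apply: boundary_closure => // -[_ /=]; rewrite bxi ltxx.
have := bd xi bxiU; rewrite ind1; apply.
have : \forall y \near within (boundary (Sigma' g L)) (nbhs xi),
    1 = \1_(bottom_face g L) y :> R.
  rewrite near_withinE.
  have N1 : nbhs xi [set y | enorm y < L].
    apply: open_nbhs_nbhs; split => //.
    by apply: open_lt_fun; [exact: enorm_continuous|exact: cst_continuous].
  have N2 : nbhs xi [set y : 'rV[R]_n.+1 | xlast y < g (xprime y)].
    apply: open_nbhs_nbhs; split; last by rewrite /= bxi; lra.
    by apply: open_lt_fun => //; exact: xlast_continuous.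
  apply: filterS2 N1 N2 => y /= y1 y2 [cy].
  rewrite ((interior_id (Sigma' g L)).1 (open_Sigma' c0 hg)) => nUy.
  rewrite indicE mem_set //; split => //=.
  have /andP[y3 _] := closure_Sigma' c0 hg cy.
  apply/eqP; rewrite eq_le y3 andbT leNgt; apply/negP => y4.
  by apply: nUy; split => //=; rewrite y4.
move=> E; exact: cvg_trans (near_eq_cvg E) (cvg_cst _).
Qed.

(** Fixes the scale of the pulse: on the side of the column, where the squared radius is [r], [Q] is
    at most the exponential of the left side. The linear term loses to the quadratic one once
    [k >= 1] and [k * r >= 2 + 4 * b]. *)
Lemma narrow_scale (R : realType) (b r : R) :
  0 < b -> 0 < r ->
  exists2 k : R, 0 < k & 2 * (b * k) - k ^+ 2 / 2 * r <= - 1.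
Proof.
move=> b0 r0; exists (1 + (2 + 4 * b) / r).
  by rewrite ltr_pwDl // divr_ge0 ?ltW // addr_gt0 // mulr_gt0.
set k := 1 + _.
have k1 : 1 <= k by rewrite lerDl divr_ge0 ?ltW // addr_gt0 // mulr_gt0.
have kr : 2 + 4 * b <= k * r.
  rewrite /k [_ * r]mulrDl divfK ?gt_eqF // mul1r lerDr; exact: ltW.
have : k * (2 + 4 * b) <= k * (k * r) by rewrite ler_wpM2l //; lra.
have : k * 2 >= 1 * 2 by rewrite ler_wpM2r.
rewrite expr2; lra.
Qed.

(** All constants are chosen before [g], [L], [w1] and [w2], which makes [C] uniform. *)
Lemma comparison (R : realType) (n : nat) (b c : R) :
  0 < b -> 0 < c <= 1 -> n%:R < b ^+ 2 -> b * c < 1 ->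
  exists C : R,
    forall (g : 'rV[R]_n -> R) (hg : elipschitz c g) (hg0 : g 0 = 0)
      (L : R) (hL : 2 <= L) (w1 w2 : 'rV[R]_n.+1 -> R),
      (forall x, Sigma' g L x -> 0 <= w1 x) ->
      dirichlet_solution (Sigma' g L) (cst 0) \1_(bottom_face g L) w1 ->
      dirichlet_solution (Sigma' g L) (cst 1) (cst 0) w2 ->
      forall x, Sigma' g (L - 1) x -> w2 x <= C * w1 x.
Proof.
move=> b0 /andP[c0 c1] nb bc.
have [B B0 HB] := torsion_bounded b0 c0 nb bc.
have bn0 : 0 < b ^+ 2 - n%:R by rewrite subr_gt0.
have := @column_in_ball R n c.
have : (64^-1 ^+ 2 : R) <= 1 by rewrite expr_le1 ?invr_ge0 // invf_le1 // ler1n.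
have : 0 < (64^-1 ^+ 2 : R) by rewrite exprn_gt0 // invr_gt0.
(* From here on [r] is the squared radius of the column, known only through [0 < r <= 1] and
   [in_ball]. *)
move: (64^-1 ^+ 2 : R) => r r0 r1 in_ball.
have [k k0 hk] := narrow_scale b0 r0.
pose s := b * k; pose K := k ^+ 2.
have s0 : 0 <= s by rewrite mulr_ge0 // ltW.
have K0 : 0 < K by rewrite exprn_gt0.
(* The first term gives [B <= kap / 2], needed where [Q = 1 / 2]; the second makes the Laplacian of
   [v] at most [1 - 4 * Q], negative where [Q > 1 / 2]. *)
pose kap := 2 * B + 4 / (K * (b ^+ 2 - n%:R)).
have kap0 : 0 < kap.
  by rewrite /kap ltr_wpDl ?mulr_ge0 // divr_gt0 // mulr_gt0.
have kapB : 2 * B <= kap by rewrite lerDl divr_ge0 // ltW // mulr_gt0.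
have kapK : 4 <= kap * (K * (b ^+ 2 - n%:R)).
  rewrite -ler_pdivrMr ?mulr_gt0 //.
  by rewrite /kap lerDr mulr_ge0.
(* Near the bottom face [w1 > 1 / 2], so [C * w1] exceeds [B + kap * expR (2 * s)], a bound for
   [w2 + kap * Q] in the column. *)
exists (2 * (B + kap * expR (2 * s))).
set C := 2 * _.
have C0 : 0 <= C by rewrite mulr_ge0 // addr_ge0 // mulr_ge0 ?expR_ge0 // ltW.
move=> g hg hg0 L hL w1 w2 w10 hw1 hw2 x0 Ux0.
have [C21 eq1 bd1] := hw1; have [C22 eq2 bd2] := hw2.
have oU := open_Sigma' (L:=L) (ltW c0) hg.
pose p := xprime x0.
pose Q := pulse s K (g p) p.
have cQ : continuous Q by exact: pulse_continuous.
(* Cutting by [hdist2 p x < r] selects the column. As [Q <= 1 / 2] on its side ([Q_side]), the cut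
   adds no boundary point with [Q > 1 / 2]. *)
pose D := Sigma' g L `&` ([set x | hdist2 p x < r] `&` [set x | 2^-1 < Q x]).
have oD : open D.
  apply: openI => //; apply: openI; apply: open_lt_fun => //;
    try exact: cst_continuous; exact: hdist2_continuous.
pose v x := kap + C * w1 x + -1 * w2 x + - (kap / 2) * wave s K (g p) p x
  + - (kap / 2) * wave (- s) K (g p) p x.
have vE x : v x = C * w1 x - w2 x - kap * (Q x - 1).
  by rewrite /v /Q /pulse; field.
(* The height difference to the vertex is at most [2]: one for the variation of [g] across the
   column, one for the thickness of the strip. *)
have strip x : g (xprime x) - 1 <= xlast x <= g (xprime x) ->
    hdist2 p x <= r -> - (2 * s) <= s * (g p - xlast x) <= 2 * s.
  move=> /andP[x1 x2] xq.
  have D2 : (g (xprime x) - g p) ^+ 2 <= 1.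
    apply: le_trans (lip_sqr _ _ (ltW c0) hg) _.
    have h : c ^+ 2 <= 1 by rewrite expr_le1 // ltW.
    have := hdist2_ge0 p x; nra.
  have D3 : -1 <= g (xprime x) - g p <= 1.
    by rewrite -ler_norml -sqrtr_sqr -[leRHS]sqrtr1 ler_wsqrtr.
  by apply/andP; split; nra.
have Q_le x : g (xprime x) - 1 <= xlast x <= g (xprime x) ->
    hdist2 p x <= r -> Q x <= expR (2 * s - K / 2 * hdist2 p x).
  move=> x1 x2; rewrite /Q pulseE expRD ler_wpM2r ?expR_ge0 //.
  exact: cosh_le_expR (strip _ x1 x2).
have Q_side x : g (xprime x) - 1 <= xlast x <= g (xprime x) ->
    hdist2 p x = r -> Q x <= 2^-1.
  move=> x1 x2; apply: le_trans (Q_le _ x1 _) _; first by rewrite x2.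
  rewrite x2.
  apply: (@le_trans _ _ (expR (-1))); first by rewrite ler_expR.
  rewrite expRN lef_pV2 ?posrE ?expR_gt0 //.
  by have := expR_ge1Dx (1 : R); lra.
have Q_top x : xlast x = g (xprime x) -> Q x <= 1.
  move=> x1; rewrite /Q pulseE x1.
  apply: (@le_trans _ _ (expR ((s * (g p - g (xprime x))) ^+ 2 / 2) * expR (- (K / 2 * hdist2 p x)))).
    by rewrite ler_wpM2r ?expR_ge0 // cosh_le_gauss.
  rewrite -expRD -[leRHS]expR0 ler_expR.
  have h := lip_sqr p x (ltW c0) hg.
  have -> : (s * (g p - g (xprime x))) ^+ 2 / 2 =
      K / 2 * (b ^+ 2 * (g (xprime x) - g p) ^+ 2) by rewrite /s /K; field.
  rewrite -mulrBr mulr_ge0_le0 //; first by rewrite ltW // divr_gt0.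
  have h1 : b ^+ 2 * (g (xprime x) - g p) ^+ 2 <= b ^+ 2 * (c ^+ 2 * hdist2 p x).
    by rewrite ler_wpM2l // sqr_ge0.
  have h2 : (b * c) ^+ 2 <= 1 by rewrite expr_le1 ?mulr_ge0 ?ltW.
  have := hdist2_ge0 p x; nra.
have q20 : hdist2 p x0 = 0.
  by rewrite /hdist2 subrr /dot big1 // => i _; rewrite mxE mul0r.
have Q0 : 1 <= Q x0 by rewrite /Q pulseE q20 mulr0 oppr0 expR0 mulr1 cosh_ge1.
have U0 : Sigma' g L x0.
  by case: Ux0 => /= h1 h2; split => //=; apply: lt_trans h1 _; lra.
have Dx0 : D x0 by split => //; split => /=; rewrite ?q20 //; lra.
suff : 0 <= v x0.
  rewrite vE; have : 0 <= kap * (Q x0 - 1).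
    by rewrite mulr_ge0 ?(ltW kap0) //; lra.
  lra.
apply: (@minimum_principle _ _ D L) Dx0 => //.
- by move=> x [[/ltW]].
- move=> x [Ux _]; rewrite /v.
  have [c1' _ _] := C21 x Ux; have [c2' _ _] := C22 x Ux.
  do 3 (apply: continuousD; last by apply: continuousM;
    [exact: cst_continuous|try exact: wave_continuous]).
  by apply: continuousD; [exact: cst_continuous|apply: continuousM => //; exact: cst_continuous].
- move=> xi cxi nxi e e0.
  have cU : closure (Sigma' g L) xi by apply: closure_subset cxi => x [].
  have xis := closure_Sigma' (ltW c0) hg cU.
  have xiq : hdist2 p xi <= r.
    apply: (closure_le_fun (f := hdist2 p) (h := cst _)) cxi.
    - exact: hdist2_continuous.
    - exact: cst_continuous.
    - by move=> x [_ [/ltW]].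
  have xiQ : 2^-1 <= Q xi.
    apply: (closure_le_fun (f := cst _) (h := Q)) cxi => //.
    - exact: cst_continuous.
    - by move=> x [_ [_ /ltW]].
  have ek : 0 < e / (2 * kap) by rewrite divr_gt0 // mulr_gt0.
  have keE : kap * (e / (2 * kap)) = e / 2 by field; rewrite gt_eqF.
  (* Where [Q xi > 1 / 2], the point is off the sphere by [in_ball] and off the side by [Q_side], so
     it lies on the graph or on the bottom face. *)
  have [Qxi|Qxi] := leP (Q xi) 2^-1.
    have : \forall x \near within D (nbhs xi), Q x < 2^-1 + e / (2 * kap).
      apply: cvg_within; apply: (cvgr_lt _ (cQ xi)); lra.
    rewrite !near_withinE; apply: filterS => x hx Dx.
    have := hx Dx; have Ux : Sigma' g L x by case: Dx.
    have := HB g L w2 hg hw2 x Ux.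
    have : 0 <= C * w1 x by rewrite mulr_ge0 // w10.
    rewrite vE => h1 h2 h3.
    have : kap * Q x < kap * (2^-1 + e / (2 * kap)) by rewrite ltr_pM2l.
    rewrite mulrDr keE; lra.
  have xin : enorm xi < L.
    by apply: (in_ball _ _ _ _ _ hg hg0 hL Ux0 xis) => //; rewrite (ltW c0).
  have nU : ~ Sigma' g L xi.
    move=> Uxi; apply: nxi; split => //; split => //=.
    rewrite lt_neqAle xiq andbT; apply/eqP => h.
    by have := Q_side _ xis h; rewrite leNgt Qxi.
  have [xitop|xibot] : xlast xi = g (xprime xi) \/ xlast xi = g (xprime xi) - 1.
    have /andP[h1 h2] := xis.
    have [h3|h3] := eqVneq (xlast xi) (g (xprime xi)); first by left.
    right; apply/eqP; rewrite eq_le h1 andbT leNgt; apply/negP => h4.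
    by apply: nU; split => //=; rewrite h4 /= lt_neqAle h3 h2.
  + have : \forall x \near within D (nbhs xi), Q x < 1 + e / (2 * kap).
      apply: cvg_within; apply: (cvgr_lt _ (cQ xi)).
      have := Q_top _ xitop; lra.
    have : \forall x \near within (Sigma' g L) (nbhs xi), w2 x < e / 2.
      have e2 : 0 < e / 2 by rewrite divr_gt0.
      apply: cvgr_lt e2.
      apply: (bd2 xi (boundary_closure cU nU)); exact: cvg_cst.
    rewrite !near_withinE; apply: filterS2 => x hx1 hx2 Dx.
    have Ux : Sigma' g L x by case: Dx.
    have := hx1 Ux; have := hx2 Dx.
    have : 0 <= C * w1 x by rewrite mulr_ge0 // w10.
    rewrite vE => h1 h2 h3.
    have : kap * Q x < kap * (1 + e / (2 * kap)) by rewrite ltr_pM2l.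
    rewrite mulrDr keE; lra.
  + have := bottom_datum (ltW c0) hg hw1 cU xin xibot.
    move=> /cvgr_gt /(_ (2^-1) _); rewrite invf_lt1 ?ltr1n // => /(_ isT).
    rewrite !near_withinE; apply: filterS => x hx Dx.
    have Ux : Sigma' g L x by case: Dx.
    have := hx Ux.
    have := HB g L w2 hg hw2 x Ux.
    rewrite vE => h1 h2.
    have : Q x <= expR (2 * s).
      have [_ /andP[u1 u2]] := Ux; have [_ [/ltW d1 _]] := Dx.
      apply: le_trans (Q_le x _ d1) _; first by apply/andP; split; exact: ltW.
      by rewrite ler_expR gerBl mulr_ge0 ?hdist2_ge0 // ltW // divr_gt0.
    move=> h3.
    have : C * 2^-1 <= C * w1 x by rewrite ler_wpM2l // ltW.
    have : kap * Q x <= kap * expR (2 * s) by rewrite ler_wpM2l // ltW.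
    rewrite /C; lra.
- move=> x [Ux [xq xQ]] _.
  exists (0 + C * laplacian w1 x + -1 * laplacian w2 x
    + - (kap / 2) * ((s ^+ 2 + K ^+ 2 * hdist2 p x - n%:R * K) * wave s K (g p) p x)
    + - (kap / 2) * (((- s) ^+ 2 + K ^+ 2 * hdist2 p x - n%:R * K) * wave (- s) K (g p) p x)).
    have := eq1 x Ux; have := eq2 x Ux; rewrite /cst /= => l2 l1.
    have {}l1 : laplacian w1 x = 0 by rewrite -[LHS]opprK l1 oppr0.
    have {}l2 : laplacian w2 x = -1 by rewrite -[LHS]opprK l2.
    rewrite l1 l2.
    (* Both waves carry the same coefficient, and [s ^ 2 - n * K = K * (b ^ 2 - n)], so they
       recombine into [Q]. *)
    have -> : 0 + C * 0 + -1 * -1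
      + - (kap / 2) * ((s ^+ 2 + K ^+ 2 * hdist2 p x - n%:R * K) * wave s K (g p) p x)
      + - (kap / 2) * (((- s) ^+ 2 + K ^+ 2 * hdist2 p x - n%:R * K) * wave (- s) K (g p) p x)
      = 1 - (kap * (K * (b ^+ 2 - n%:R)) + kap * K ^+ 2 * hdist2 p x) * Q x.
      by rewrite /Q /pulse /s /K; field.
    have h : 0 <= kap * K ^+ 2 * hdist2 p x.
      by rewrite mulr_ge0 ?hdist2_ge0 // mulr_ge0 ?sqr_ge0 // ltW.
    by clear -kapK h xQ; move: xQ => /= xQ; nra.
  apply: has_laplacian_lin; last exact: has_laplacian_wave.
  apply: has_laplacian_lin; last exact: has_laplacian_wave.
  apply: has_laplacian_lin; last exact: has_laplacian_laplacian C22 Ux.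
  apply: has_laplacian_lin; last exact: has_laplacian_laplacian C21 Ux.
  exact: has_laplacian_cst.
Qed.

(** * The opening of degree two *)

Lemma enormZ (R : realType) (d : nat) (t : R) (x : 'rV[R]_d) :
  0 <= t -> enorm (t *: x) = t * enorm x.
Proof.
move=> t0; rewrite /enorm.
have -> : dot (t *: x) (t *: x) = t ^+ 2 * dot x x.
  by rewrite /dot mulr_sumr; apply: eq_bigr => i _; rewrite !mxE; ring.
by rewrite sqrtrM ?sqr_ge0 // sqrtr_sqr ger0_norm.
Qed.

Lemma enorm_eq0 (R : realType) (d : nat) (x : 'rV[R]_d) : enorm x = 0 -> x = 0.
Proof.
move=> e0; apply/eqP; rewrite -normr_eq0 eq_le normr_ge0 andbT -e0.
exact: norm_le_enorm.
Qed.

Lemma hdist2_zero (R : realType) (n : nat) (x : 'rV[R]_n.+1) :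
  hdist2 0 x = enorm x ^+ 2 - xlast x ^+ 2.
Proof. by rewrite enorm_sqr dot_prime_last /hdist2 subr0 expr2 addrK. Qed.

Lemma xlast_le_enorm (R : realType) (n : nat) (x : 'rV[R]_n.+1) :
  `|xlast x| <= enorm x.
Proof.
rewrite -sqrtr_sqr ler_wsqrtr // dot_prime_last -expr2 lerDr; exact: dot_ge0.
Qed.

Lemma xlastZ (R : realType) (n : nat) (t : R) (x : 'rV[R]_n.+1) :
  xlast (t *: x) = t * xlast x.
Proof. by rewrite /xlast mxE. Qed.

Lemma dot_axis (R : realType) (n : nat) (x : 'rV[R]_n.+1) :
  dot x (delta_mx 0 ord_max) = xlast x.
Proof.
rewrite /dot (bigD1 ord_max) //= mxE !eqxx mulr1 big1 ?addr0 // => i /negbTE h.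
by rewrite mxE h andbF mulr0.
Qed.

Lemma enorm_axis (R : realType) (n : nat) :
  enorm (delta_mx 0 ord_max : 'rV[R]_n.+1) = 1.
Proof. by rewrite /enorm dot_axis /xlast mxE !eqxx sqrtr1. Qed.

(** The cosine is decreasing on [[0, pi]], so the angle condition becomes one without [acos] or
    division; the apex satisfies both sides. *)
Lemma cone_axisE (R : realType) (n : nat) (theta : R) (x : 'rV[R]_n.+1) :
  0 < theta < pi ->
  cone theta (delta_mx 0 ord_max) x <-> cos theta * enorm x <= xlast x.
Proof.
move=> /andP[th0 thpi]; rewrite /cone /angle /= dot_axis enorm_axis mulr1.
have [->|x0] := eqVneq x 0.
  have -> : enorm (0 : 'rV[R]_n.+1) = 0.
    by rewrite -(scale0r (0 : 'rV[R]_n.+1)) enormZ // mul0r.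
  by rewrite mulr0 /xlast mxE lexx; split => // _; left.
have n0 : 0 < enorm x.
  rewrite lt_neqAle sqrtr_ge0 andbT eq_sym; apply: contra_neq x0; exact: enorm_eq0.
have z1 : -1 <= xlast x / enorm x <= 1.
  by rewrite -ler_norml normrM normfV (gtr0_norm n0) ler_pdivrMr // mul1r xlast_le_enorm.
have -> : (cos theta * enorm x <= xlast x) = (acos (xlast x / enorm x) <= theta).
  rewrite -ler_pdivlMr // [RHS]leNgt -ltr_cos.
  - by rewrite acosK ?in_itv //= leNgt.
  - by rewrite in_itv /= (ltW th0) (ltW thpi).
  - by rewrite in_itv /= acos_ge0 // acos_lepi.
by split => [[/eqP|//]|]; [rewrite (negbTE x0)|right].
Qed.

(* If [theta] were smaller than the opening of the cone [a x_d ^ 2 > |x'| ^ 2] with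
   [a < n], the degree-2 function [quad a 0 0] would be a positive strict
   supersolution in the closed cone of opening [theta]; a homogeneous solution
   touches the smallest of its multiples lying above at an interior point. *)
Lemma half_opening_two (R : realType) (n : nat) (theta c : R) :
  is_half_opening n.+1 2 theta -> 0 < c -> c < cot theta -> n%:R * c ^+ 2 < 1.
Proof.
move=> [/andP[th0 th2] hu] c0 cth; rewrite ltNge; apply/negP => nc.
pose mu : 'rV[R]_n.+1 := delta_mx 0 ord_max.
have pi0 := pi_gt0 R.
have thpi : 0 < theta < pi by rewrite th0 /=; lra.
have C0 : 0 < cos theta by apply: cos_gt0_pihalf; lra.
have S0 : 0 < sin theta by apply: sin_gt0_pi.
have CS : cos theta ^+ 2 + sin theta ^+ 2 = 1 by exact: cos2Dsin2.
have cSC : c * sin theta < cos theta by move: cth; rewrite /cot ltr_pdivlMr.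
move: CS cSC C0 S0; set C := cos theta; set S := sin theta => CS cSC C0 S0.
(* The negated conclusion [1 <= n * c ^ 2] together with [c < cot theta] gives
   [tan theta ^ 2 < n]. *)
have SnC : S ^+ 2 < n%:R * C ^+ 2.
  have h1 : (c * S) ^+ 2 < C ^+ 2 by rewrite ltr_pXn2r ?nnegrE ?mulr_ge0 // ltW.
  have n0 : 0 < n%:R :> R.
    rewrite lt0r ler0n andbT; apply/eqP => n0; move: nc; rewrite n0 mul0r; lra.
  have h2 : n%:R * (c * S) ^+ 2 < n%:R * C ^+ 2 by rewrite ltr_pM2l.
  by apply: le_lt_trans h2; rewrite exprMn mulrA ler_peMl ?sqr_ge0.
have C20 : 0 < C ^+ 2 by rewrite exprn_gt0.
have [t [tge0 tn tC]] : exists t : R, [/\ 0 <= t, t < n%:R & t * C ^+ 2 = S ^+ 2].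
  exists (S ^+ 2 / C ^+ 2); split; first by rewrite divr_ge0 ?sqr_ge0.
    by rewrite ltr_pdivrMr.
  by rewrite divfK // gt_eqF.
(* Strictly between [t = tan theta ^ 2] and [n]: [a > t] makes [q] positive on the cone away from
   the apex, with lower bound [m * enorm x ^ 2], and [a < n] makes its Laplacian negative. *)
pose a := (t + n%:R) / 2.
have an : a < n%:R by rewrite /a; lra.
have ta : t < a by rewrite /a; lra.
have m0 : 0 < (a + 1) * C ^+ 2 - 1.
  have : S ^+ 2 < a * C ^+ 2 by rewrite -tC ltr_pM2r.
  lra.
move: m0; set m := (_ - 1) => m0.
pose q := quad a 0 (0 : 'rV[R]_n).
have qE x : q x = (a + 1) * xlast x ^+ 2 - enorm x ^+ 2.
  by rewrite /q /quad hdist2_zero subr0; ring.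
have cq : continuous q by exact: quad_continuous.
have [u [[C2 equ bdu] u0 hom]] := hu mu (enorm_axis R n).
set W := (cone theta mu)° in C2 equ bdu u0 hom.
have oW : open W by exact: open_interior.
have Wcone x : W x -> C * enorm x <= xlast x.
  by move=> /interior_subset /(cone_axisE _ thpi).
have coneW x : C * enorm x < xlast x -> W x.
  move=> h; have : nbhs x [set x : 'rV[R]_n.+1 | C * enorm x < xlast x].
    apply: open_nbhs_nbhs; split => //.
    apply: open_lt_fun; last exact: xlast_continuous.
    by move=> y; apply: continuousM; [exact: cst_continuous|exact: enorm_continuous].
  by apply: filterS => y /= /ltW hy; apply/(cone_axisE _ thpi).
have qW x : W x -> m * enorm x ^+ 2 <= q x.
  move=> /Wcone h; rewrite qE /m mulrBl mul1r lerD2r -mulrA -exprMn.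
  have a1 : 0 <= a + 1 by rewrite addr_ge0 // (le_trans tge0) // ltW.
  rewrite ler_wpM2l // ler_pXn2r ?nnegrE ?mulr_ge0 ?sqrtr_ge0 ?(ltW C0) //.
  by apply: le_trans h; rewrite mulr_ge0 ?sqrtr_ge0 ?(ltW C0).
have Wmu : W mu.
  apply: coneW; rewrite enorm_axis mulr1 /mu /xlast mxE !eqxx /=.
  have : 0 < S ^+ 2 by rewrite exprn_gt0.
  nra.
(* The apex is not an interior point of the cone: small multiples of [- mu] have negative height. *)
have W0 x : W x -> 0 < enorm x.
  move=> Wx; rewrite lt_neqAle sqrtr_ge0 andbT eq_sym; apply/eqP => /enorm_eq0 x0.
  have := line_near mu oW Wx; rewrite x0 => -[e /= e0 He].
  have := He (- (e / 2)); rewrite /= sub0r opprK gtr0_norm ?divr_gt0 //.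
  move=> /(_ ltac:(lra)) /Wcone; rewrite add0r xlastZ.
  rewrite (_ : xlast mu = 1) ?mulr1; last by rewrite /xlast mxE !eqxx.
  have : 0 <= C * enorm (- (e / 2) *: mu) by rewrite mulr_ge0 ?sqrtr_ge0 ?(ltW C0).
  lra.
have WZ l x : 0 < l -> W x -> W (l *: x).
  move=> l0 Wx.
  have cl : l^-1 *: y @[y --> l *: x] --> x.
    have -> : nbhs x = nbhs (l^-1 *: (l *: x)).
      by rewrite scalerA mulVf ?gt_eqF // scale1r.
    exact: scaler_continuous.
  have : \forall y \near l *: x, cone theta mu (l^-1 *: y) by exact: cl Wx.
  apply: filterS => y /= /(cone_axisE _ thpi).
  have l1 : 0 < l^-1 by rewrite invr_gt0.
  rewrite enormZ ?(ltW l1) // xlastZ mulrCA ler_pM2l // => h.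
  exact/(cone_axisE _ thpi).
(* The value [0] outside [W] makes the ratio continuous on the unit sphere: [u] tends to [0] at the
   boundary of [W], while [q >= m / 4] at points of [W] with norm above [1 / 2]. Its maximum is
   positive, hence attained in [W]. *)
pose r (x : 'rV[R]_n.+1) := if x \in (W : set 'rV[R]_n.+1) then u x / q x else 0.
have rW x : W x -> r x = u x / q x by move=> Wx; rewrite /r mem_set.
have rN x : ~ W x -> r x = 0 by move=> Wx; rewrite /r memNset.
have q0 x : W x -> 0 < q x.
  by move=> Wx; apply: lt_le_trans (qW x Wx); rewrite mulr_gt0 // exprn_gt0 // W0.
pose Sph := [set x : 'rV[R]_n.+1 | enorm x = 1].
have cSph : compact Sph.
  apply: (@compact_enorm _ _ _ 1); last by move=> x ->.
  apply: (@closed_comp _ _ (@enorm R n.+1) [set 1]); last exact: closed_eq.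
  by move=> x _; exact: enorm_continuous.
have cr x : Sph x -> r y @[y --> x] --> r x.
  move=> Sx; have [Wx|nWx] := pselect (W x).
    have cu : {for x, continuous (fun y => u y / q y)}.
      have [cu _ _] := C2 x Wx.
      apply: continuousM => //; apply: continuousV; last exact: cq.
      by rewrite gt_eqF // q0.
    have E : \forall y \near x, u y / q y = r y.
      have : nbhs x W by exact: open_nbhs_nbhs.
      by apply: filterS => y Wy; rewrite rW.
    rewrite rW //; exact: cvg_trans (near_eq_cvg E) cu.
  rewrite rN //; apply/(@cvgrPdist_lt _ _ _ (nbhs x) (nbhs_filter x)) => e e0.
  have [cx|ncx] := pselect (closure W x); last first.
    have : nbhs x (~` closure W).
      by apply: open_nbhs_nbhs; split => //; rewrite openC; exact: closed_closure.
    apply: filterS => y nWy; rewrite rN ?subrr ?normr0 //.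
    by move=> /subset_closure.
  have e1 : 0 < e * (m / 4) by rewrite mulr_gt0 // divr_gt0.
  have : \forall y \near within W (nbhs x), u y < e * (m / 4).
    apply: cvgr_lt e1.
    by apply: (bdu x (boundary_closure cx nWx)); exact: cvg_cst.
  have : \forall y \near x, 2^-1 < enorm y.
    apply: (cvgr_gt _ (@enorm_continuous R n.+1 x)); rewrite Sx; lra.
  rewrite near_withinE; apply: filterS2 => y y1 y2.
  rewrite sub0r normrN; have [Wy|nWy] := pselect (W y); last by rewrite rN // normr0.
  rewrite rW // ger0_norm; last by rewrite divr_ge0 // ltW // ?u0 ?q0.
  rewrite ltr_pdivrMr ?q0 //; apply: lt_le_trans (y2 Wy) _.
  rewrite ler_wpM2l ?(ltW e0) //; apply: le_trans (qW y Wy).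
  rewrite ler_wpM2l ?(ltW m0) //; nra.
have cr' : {within Sph, continuous r}.
  by apply: continuous_in_subspaceT => x; rewrite inE => /cr.
have Smu : Sph mu by exact: enorm_axis.
have [z zS zmax] := compact_EVT_max (ex_intro _ mu Smu) cSph cr'.
have rmu : 0 < r mu by rewrite rW // divr_gt0 // ?u0 ?q0.
have M0 : 0 < r z by apply: lt_le_trans rmu _; apply: zmax; rewrite inE.
have Wz : W z by apply: contrapT => /rN h; move: M0; rewrite h ltxx.
(* Both [u] and [q] are homogeneous of degree two, so the bound on the sphere extends to the whole
   cone. *)
have uq x : W x -> u x <= r z * q x.
  move=> Wx; have n0 := W0 x Wx; have t0 : 0 < (enorm x)^-1 by rewrite invr_gt0.
  have Wy := WZ _ _ t0 Wx.
  have := zmax ((enorm x)^-1 *: x); rewrite inE => /(_ _).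
  rewrite rW // ler_pdivrMr ?q0 // hom // powR_mulrn ?(ltW t0) //.
  have -> : q ((enorm x)^-1 *: x) = (enorm x)^-1 ^+ 2 * q x.
    by rewrite !qE enormZ ?(ltW t0) // xlastZ; ring.
  rewrite mulrCA ler_pM2l ?exprn_gt0 //; apply.
  by rewrite /Sph /= enormZ ?(ltW t0) // mulVf ?gt_eqF.
(* [f] is nonnegative on [W] and vanishes at [z], yet its Laplacian there is
   [r z * 2 * (a - n) < 0]. *)
pose f x := r z * q x + -1 * u x.
have : 0 <= r z * (2 * (a - n%:R)) + -1 * laplacian u z.
  apply: (@has_laplacian_min _ _ W f z) => //.
    move=> y Wy; rewrite /f [r z in leLHS]rW // divfK ?gt_eqF ?q0 //.
    by have := uq y Wy; lra.
  apply: has_laplacian_lin; last exact: has_laplacian_laplacian C2 Wz.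
  have := has_laplacian_lin (r z) (has_laplacian_cst 0 z) (has_laplacian_quad a 0 (0 : 'rV[R]_n) z).
  rewrite add0r (_ : (fun y => _) = (fun y => r z * q y)) //.
  by apply/funext => y; rewrite add0r.
have -> : laplacian u z = 0 by rewrite -[LHS]opprK equ // oppr0.
rewrite mulr0 addr0 pmulr_rge0 //; lra.
Qed.

(** * From the angle condition to the comparison *)

Unset Implicit Arguments.

Theorem proposition4p1 (R : realType) (n : nat) (hn : (0 < n)%N)
    (theta2 : R) (htheta2 : is_half_opening n.+1 2 theta2)
    (cg : R) (hcg : 0 < cg) (hcgtheta2 : cg < cot theta2) :
  exists C : R,
    forall (g : 'rV[R]_n -> R) (hg : elipschitz cg g) (hg0 : g 0 = 0)
      (L : R) (hL : 2 <= L) (w1 w2 : 'rV[R]_n.+1 -> R),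
      (forall x, Sigma' g L x -> 0 <= w1 x) ->
      (forall x, Sigma' g L x -> 0 <= w2 x) ->
      dirichlet_solution (Sigma' g L) (cst 0) \1_(bottom_face g L) w1 ->
      dirichlet_solution (Sigma' g L) (cst 1) (cst 0) w2 ->
      forall x, Sigma' g (L - 1) x -> w2 x <= C * w1 x.
Proof.
have nc := half_opening_two htheta2 hcg hcgtheta2.
have c2 : 0 < cg ^+ 2 by rewrite exprn_gt0.
have c1 : cg <= 1.
  rewrite -(@ler_pXn2r _ 2) ?nnegrE ?(ltW hcg) // expr1n ltW //.
  by apply: le_lt_trans nc; rewrite ler_peMl ?(ltW c2) // ler1n.
have cV : n%:R < (cg ^+ 2)^-1 by rewrite -[ltRHS]div1r ltr_pdivlMr.
(* The slope [b] of the comparison is [Num.sqrt s]: since [n * cg ^ 2 < 1], the midpoint of [n] and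
   [cg ^ -2] satisfies both [n < b ^ 2] and [b * cg < 1]. *)
pose s := (n%:R + (cg ^+ 2)^-1) / 2.
have sn : n%:R < s by rewrite /s; lra.
have s0 : 0 < s by apply: le_lt_trans sn; rewrite ler0n.
have b2 : Num.sqrt s ^+ 2 = s by rewrite sqr_sqrtr // ltW.
have bc : Num.sqrt s * cg < 1.
  rewrite -(@ltr_pXn2r _ 2) ?nnegrE ?mulr_ge0 ?sqrtr_ge0 ?(ltW hcg) //.
  by rewrite expr1n exprMn b2 -ltr_pdivlMr // div1r /s; lra.
have b0 : 0 < Num.sqrt s by rewrite sqrtr_gt0.
have c01 : 0 < cg <= 1 by rewrite hcg.
have nb : n%:R < Num.sqrt s ^+ 2 by rewrite b2.
have [C HC] := comparison b0 c01 nb bc.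
exists C => g hg hg0 L hL w1 w2 w10 _; exact: HC.
Qed.
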